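(* Let $\mathcal A=(a,s)$ be a frozen artifact with cells $C_i=[\ell_i,u_i]$, capped widths $W_i$, margin $\mu$, and invariant set $\mathcal C=\prod_{i=1}^N C_i$ (as defined in the context). (1) If $w'\in\mathcal C$, then re-quantization of $w'$ under the frozen scales $s$ returns exactly the codes $a$, i.e. the code assigned to $w'_i$ is $a_i$ for every $i$. (2) If $w'\in\mathcal C$ and $\tilde w\in\mathbb R^N$ is a stored representation of $w'$ whose rounding error satisfies $|\tilde w_i-w'_i|<\mu W_i$ for every coordinate $i$, then re-quantization of $\tilde w$ under the frozen scales also returns exactly $a$. (3) Consequently, for any composition of updates (maps $\mathbb R^N\to\mathbb R^N$ applied one after another) whose images lie in $\mathcal C$, re-quantizing the result under the frozen scales returns exactly $a$, so the artifact $(a,s)$ is preserved bit-for-bit.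
   Context: Level table: reals $L[0]<L[1]<\dots<L[15]$, with midpoints $M[j]=(L[j]+L[j+1])/2$ for $j=0,\dots,14$, and conventions $M[-1]=-\infty$, $M[15]=+\infty$. There are $N$ weights partitioned into blocks (groups); $g(i)$ denotes the block of weight $i$. The frozen artifact consists of codes $a\in\{0,\dots,15\}^N$ and group scales $s$ with $s_g>0$ for every block $g$. The anchor of weight $i$ is $\hat w_i=s_{g(i)}L[a_i]$. Re-quantization under frozen scales assigns to a real weight $w_i$ the code $\#\{j\in\{0,\dots,14\}: M[j]<w_i/s_{g(i)}\}$ (round to nearest, scales not recomputed). The decision region of weight $i$ is thus $D_i=\{x: s_{g(i)}M[a_i-1]<x\le s_{g(i)}M[a_i]\}$. Capped cell: in normalized units, $\mathrm{lo}[j]=M[j-1]$ for $j\ge1$ and $\mathrm{hi}[j]=M[j]$ for $j\le 14$; the two outer ends are capped by mirroring the inner half-gap about the level: $\mathrm{lo}[0]=L[0]-(M[0]-L[0])$, $\mathrm{hi}[15]=L[15]+(L[15]-M[14])$. Put $\mathrm{lo}_i=s_{g(i)}\mathrm{lo}[a_i]$, $\mathrm{hi}_i=s_{g(i)}\mathrm{hi}[a_i]$, $W_i=\mathrm{hi}_i-\mathrm{lo}_i$ (the capped width). With a margin $\mu\in(0,1/2)$ (the value used in practice is $\mu=0.01$), the cell is $C_i=[\ell_i,u_i]$ with $\ell_i=\mathrm{lo}_i+\mu W_i$ and $u_i=\mathrm{hi}_i-\mu W_i$. *)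

(* Defs.v *)
From HB Require Import structures.
From mathcomp Require Import all_boot all_order all_algebra.
From mathcomp Require Import boolp classical_sets reals.

Set Implicit Arguments.
Unset Strict Implicit.
Unset Printing Implicit Defensive.

Import Order.TTheory GRing.Theory Num.Theory.
Local Open Scope classical_set_scope.
Local Open Scope ring_scope.

Section LevelTable.
Context {R : realType}.
Variable L : 'I_16 -> R.

(* Meaningful for j < 15 only: beyond that the [inord] indices are clipped
   to 0. Every use below stays in range. *)
Definition midpoint (j : nat) : R := (L (inord j) + L (inord j.+1)) / 2.

Lemma level_code_subproof (x : R) : (#|[pred j : 'I_15 | (midpoint j < x)%R]| < 16)%N.
Proof. by rewrite ltnS -[leqRHS]card_ord max_card. Qed.

Definition level_code (x : R) : 'I_16 := Ordinal (level_code_subproof x).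

Definition level_lo (j : 'I_16) : R :=
  if j == ord0 then L ord0 - (midpoint 0 - L ord0) else midpoint j.-1.

Definition level_hi (j : 'I_16) : R :=
  if j == ord_max then L ord_max + (L ord_max - midpoint 14) else midpoint j.

End LevelTable.

Record artifact (R : realType) (N : nat) (G : finType) := Artifact {
  codes : {ffun 'I_N -> 'I_16};
  scales : G -> R;
  scales_gt0 : forall b : G, 0 < scales b }.

Section Cells.
Context {R : realType} {N : nat} {G : finType}.
(* The level table, and the map sending a weight index to its block. *)
Variables (L : 'I_16 -> R) (g : 'I_N -> G).

Definition requantize (s : G -> R) (w : 'rV[R]_N) : {ffun 'I_N -> 'I_16} :=
  [ffun i => level_code L (w ord0 i / s (g i))].

Definition requantized_artifact (A : artifact R N G) (w : 'rV[R]_N) :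
    artifact R N G :=
  Artifact (requantize (scales A) w) (scales_gt0 A).

Variables (A : artifact R N G).

Definition weight_lo (i : 'I_N) : R := scales A (g i) * level_lo L (codes A i).

Definition weight_hi (i : 'I_N) : R := scales A (g i) * level_hi L (codes A i).

Definition capped_width (i : 'I_N) : R := weight_hi i - weight_lo i.

Definition cell (mu : R) (i : 'I_N) : set R :=
  [set x | weight_lo i + mu * capped_width i <= x
           <= weight_hi i - mu * capped_width i].

Definition invariant_set (mu : R) : set 'rV[R]_N :=
  [set w | forall i, cell mu i (w ord0 i)].

End Cells.

(* The head of the list is applied first. *)
Definition run_updates (T : Type) (us : seq (T -> T)) (w : T) : T :=
  foldl (fun v u => u v) w us.

(* Main.v *)
(** The midpoints increase, so the code of [x] is [a] as soon as [x] lies in the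
    half-open interval from [level_lo a] to [level_hi a]; capping the two outer
    ends only shrinks the decision region. The margin [mu * W_i] keeps the cell
    inside the interior of this interval, and a rounding error below the margin
    cannot leave it. *)

Require Import Defs.
From HB Require Import structures.
From mathcomp Require Import all_boot all_order all_algebra.
From mathcomp Require Import boolp classical_sets reals.
From mathcomp Require Import lra.

Set Implicit Arguments.
Unset Strict Implicit.
Unset Printing Implicit Defensive.

Import Order.TTheory GRing.Theory Num.Theory.
Local Open Scope classical_set_scope.
Local Open Scope ring_scope.

Section LevelTableTheory.
Context {R : realType}.
Variable L : 'I_16 -> R.
Hypothesis hL : forall i j : 'I_16, (i < j)%N -> L i < L j.

Lemma midpoint_between (j : nat) : (j < 15)%N ->
  L (inord j) < midpoint L j < L (inord j.+1).
Proof.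
move=> hj; have : L (inord j) < L (inord j.+1).
  by apply: hL; rewrite !inordK // ltnW.
by rewrite /midpoint => h; apply/andP; split; lra.
Qed.

Lemma midpoint_le (j k : nat) : (j <= k)%N -> (k < 15)%N ->
  midpoint L j <= midpoint L k.
Proof.
have L_le (m n : 'I_16) : (m <= n)%N -> L m <= L n.
  by rewrite leq_eqVlt => /orP[/eqP/val_inj ->//|/hL/ltW].
move=> jk hk; have hj := leq_ltn_trans jk hk.
have h0 : L (inord j) <= L (inord k) by apply: L_le; rewrite !inordK // ltnW.
have h1 : L (inord j.+1) <= L (inord k.+1) by apply: L_le; rewrite !inordK.
by rewrite /midpoint; lra.
Qed.

Lemma level_lo_lt (a : 'I_16) : level_lo L a < L a.
Proof.
rewrite /level_lo; case: eqP => [->|/eqP a0].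
  (* The cap mirrors the half-gap about the level, so it lies below [L ord0] because [midpoint L 0]
     lies above; the top end is symmetric. *)
  have /andP[+ _] := @midpoint_between 0 isT.
  by rewrite (_ : inord 0 = ord0); [lra|apply: val_inj; rewrite /= inordK].
have a_gt0 : (0 < a)%N by rewrite lt0n.
have /andP[_] : L (inord a.-1) < midpoint L a.-1 < L (inord a.-1.+1).
  by apply: midpoint_between; rewrite -ltnS prednK.
by rewrite prednK // inord_val.
Qed.

Lemma lt_level_hi (a : 'I_16) : L a < level_hi L a.
Proof.
rewrite /level_hi; case: eqP => [->|/eqP a15].
  have /andP[_ +] := @midpoint_between 14 isT.
  by rewrite (_ : inord 15 = ord_max); [lra|apply: val_inj; rewrite /= inordK].
have a_lt15 : (a < 15)%N by rewrite ltn_neqAle a15 -ltnS ltn_ord.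
by have /andP[+ _] := midpoint_between a_lt15; rewrite inord_val.
Qed.

(** Since the midpoints increase, those below [x] are exactly the ones of index less than [a], and
    there are [a] of them. A capped end is never compared with a midpoint, as no index lies beyond
    it. *)
Lemma level_codeP (a : 'I_16) (x : R) :
  level_lo L a < x -> x <= level_hi L a -> level_code L x = a.
Proof.
move=> lox xhi; apply: val_inj => /=.
have a_le15 : (a <= 15)%N by rewrite -ltnS.
rewrite (@eq_card _ _ [pred j : 'I_15 | (j < a)%N]); last first.
  move=> j; rewrite !inE; case: ltnP => [ja|aj].
    (* The mere existence of [j < a] excludes code 0, so [level_lo L a] is a true midpoint and not
       the cap. *)
    have a_gt0 : (0 < a)%N by apply: leq_ltn_trans ja.
    apply: le_lt_trans lox; rewrite /level_lo ifN -?lt0n //.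
    by apply: midpoint_le; rewrite -ltnS prednK.
  (* Likewise [a <= j] with [j : 'I_15] excludes code 15, the only one with a capped upper end. *)
  have a_lt15 : (a < 15)%N by apply: leq_ltn_trans (ltn_ord j).
  apply/negbTE; rewrite -leNgt; apply: le_trans xhi _.
  rewrite /level_hi ifN; first exact: midpoint_le.
  by apply: contraTneq a_lt15 => ->.
by rewrite -sum1_card (big_ord_narrow a_le15) sum1_card card_ord.
Qed.

End LevelTableTheory.

Section RequantizeTheory.
Context {R : realType} {N : nat} {G : finType}.
Variables (L : 'I_16 -> R) (g : 'I_N -> G) (A : artifact R N G).
Hypothesis hL : forall i j : 'I_16, (i < j)%N -> L i < L j.

Lemma capped_width_gt0 (i : 'I_N) : 0 < capped_width L g A i.
Proof.
rewrite subr_gt0 ltr_pM2l ?scales_gt0 //.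
exact: lt_trans (level_lo_lt hL _) (lt_level_hi hL _).
Qed.

Lemma requantize_codes (w : 'rV[R]_N) :
  (forall i, weight_lo L g A i < w ord0 i <= weight_hi L g A i) ->
  requantize L g (scales A) w = codes A.
Proof.
move=> hw; apply/ffunP => i; rewrite ffunE; have /andP[lo hi] := hw i.
have s_gt0 := scales_gt0 A (g i).
apply: level_codeP => //; first by rewrite ltr_pdivlMr // mulrC.
by rewrite ler_pdivrMr // mulrC.
Qed.

Lemma requantize_perturbed (mu : R) (w' wt : 'rV[R]_N) :
  invariant_set L g A mu w' ->
  (forall i, `|wt ord0 i - w' ord0 i| < mu * capped_width L g A i) ->
  requantize L g (scales A) wt = codes A.
Proof.
move=> hw' hwt; apply: requantize_codes => i.
have /andP[lo hi] := hw' i; have := hwt i; rewrite ltr_norml => /andP[h1 h2].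
by apply/andP; split; lra.
Qed.

(** This is the case of zero rounding error; the strict error bound then asks for a positive margin,
    which [capped_width_gt0] supplies. *)
Lemma requantize_invariant_set (mu : R) (w : 'rV[R]_N) : 0 < mu ->
  invariant_set L g A mu w -> requantize L g (scales A) w = codes A.
Proof.
move=> mu0 hw; apply: (requantize_perturbed hw) => i.
by rewrite subrr normr0 mulr_gt0 // capped_width_gt0.
Qed.

(** Scales and their positivity proof are carried over unchanged, so equal codes give equality of
    the whole record. *)
Lemma requantized_artifact_id (w : 'rV[R]_N) :
  requantize L g (scales A) w = codes A -> requantized_artifact L g A w = A.
Proof. by rewrite /requantized_artifact => ->; case: A. Qed.

End RequantizeTheory.

(** The result is a value of the last update, so it lies in that update's range wherever [w] is. The
    empty composition would return [w] itself, which may lie outside [C]. *)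
Lemma run_updates_in (T : eqType) (C : set T) (us : seq (T -> T)) (w : T) :
  us <> [::] -> (forall u, u \in us -> range u `<=` C) -> C (run_updates us w).
Proof.
case/lastP: us => // us u _ /(_ u); rewrite mem_rcons mem_head => /(_ isT).
by rewrite /run_updates foldl_rcons; apply; exists (run_updates us w).
Qed.

Theorem proposition1 (R : realType) (N : nat) (G : finType)
    (L : 'I_16 -> R) (hL : forall i j : 'I_16, (i < j)%N -> L i < L j)
    (g : 'I_N -> G) (A : artifact R N G)
    (mu : R) (hmu0 : 0 < mu) (hmu1 : mu < 1 / 2) :
  [/\ forall w' : 'rV[R]_N, invariant_set L g A mu w' ->
        requantize L g (scales A) w' = codes A,
      forall w' wt : 'rV[R]_N, invariant_set L g A mu w' ->
        (forall i : 'I_N,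
           `|wt ord0 i - w' ord0 i| < mu * capped_width L g A i) ->
        requantize L g (scales A) wt = codes A
    & forall us : seq ('rV[R]_N -> 'rV[R]_N), us <> [::] ->
        (forall u, u \in us -> range u `<=` invariant_set L g A mu) ->
        forall w : 'rV[R]_N,
          requantize L g (scales A) (run_updates us w) = codes A
          /\ requantized_artifact L g A (run_updates us w) = A].
Proof.
split=> [w'|w' wt|us us0 hus w].
- exact: requantize_invariant_set.
- exact: requantize_perturbed.
- have hw : requantize L g (scales A) (run_updates us w) = codes A.
    exact: requantize_invariant_set hmu0 (run_updates_in w us0 hus).
  by split; last exact: requantized_artifact_id.
Qed.
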